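(* Let $\Phi(x,y)=(P(x,y),Q(x,y))$ be a divergence-free jacobian map of degree $n$. Then there exist $\alpha,\beta\in\mathbb{R}$ with $\alpha^2+\beta^2\neq 0$ and $\varepsilon_2,\dots,\varepsilon_n\in\mathbb{R}$ such that $$P(x,y)=x+\sum_{i=2}^n\varepsilon_i\,\alpha(\beta x-\alpha y)^i,\qquad Q(x,y)=y+\sum_{i=2}^n\varepsilon_i\,\beta(\beta x-\alpha y)^i.$$
   Context: A jacobian map is a real polynomial map $\Phi:\mathbb{R}^2\to\mathbb{R}^2$ whose jacobian determinant $\det J_\Phi$ is a non-zero constant. A divergence-free jacobian map is a jacobian map of the form $P(x,y)=x+\sum_{i=2}^n p_i(x,y)$, $Q(x,y)=y+\sum_{i=2}^n q_i(x,y)$, where $p_i,q_i$ are real homogeneous polynomials of degree $i$, such that $\frac{\partial}{\partial x}\sum_{i=2}^n p_i+\frac{\partial}{\partial y}\sum_{i=2}^n q_i=0$ identically. Its degree is the maximal total degree of $P,Q$. *)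

(* Defs.v *)
From mathcomp Require Import all_boot all_order all_algebra.
From mathcomp Require Import reals.
From mathcomp Require Import mpoly.
Set Implicit Arguments. Unset Strict Implicit. Unset Printing Implicit Defensive.
Import GRing.Theory Num.Theory.
Local Open Scope ring_scope.

Definition vx {R : realType} : {mpoly R[2]} := 'X_(ord0 : 'I_2).
Definition vy {R : realType} : {mpoly R[2]} := 'X_(ord_max : 'I_2).

Definition dx {R : realType} (p : {mpoly R[2]}) := mderiv (ord0 : 'I_2) p.
Definition dy {R : realType} (p : {mpoly R[2]}) := mderiv (ord_max : 'I_2) p.

Definition jac_det {R : realType} (P Q : {mpoly R[2]}) : {mpoly R[2]} :=
  dx P * dy Q - dy P * dx Q.

Definition jacobian_map {R : realType} (P Q : {mpoly R[2]}) : Prop :=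
  exists c : R, c != 0 /\ jac_det P Q = c%:MP.

Definition divfree_jacobian_map {R : realType} (P Q : {mpoly R[2]}) : Prop :=
  jacobian_map P Q /\
  exists (N : nat) (p q : nat -> {mpoly R[2]}),
    (forall i, (2 <= i <= N)%N -> p i \is i.-homog) /\
    (forall i, (2 <= i <= N)%N -> q i \is i.-homog) /\
    P = vx + \sum_(2 <= i < N.+1) p i /\
    Q = vy + \sum_(2 <= i < N.+1) q i /\
    dx (\sum_(2 <= i < N.+1) p i) + dy (\sum_(2 <= i < N.+1) q i) = 0.

(* degree of the map: maximal total degree of P and Q
   (msize p = 1 + total degree for p != 0, and 0 for p = 0) *)
Definition map_degree {R : realType} (P Q : {mpoly R[2]}) : nat :=
  (maxn (msize P) (msize Q)).-1.

(* Main.v *)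
(** Writing P = x + p and Q = y + q, vanishing divergence makes (-q, p) a
gradient (u, v), and the Jacobian condition says that its Jacobian matrix, a
Hessian, is singular. Where E := u_x <> 0, put m := u_y / u_x; then m solves the
Burgers equation m_y = m m_x, so m, and hence u, is constant along the line
z + t (-m(z), 1). Lines of different slopes meet, so u takes the same value at
any two points where m differs; as u is not constant, m is a constant. Thus
v = m u and u depends on x + m y only. *)
Require Import Defs.
From HB Require Import structures.
From mathcomp Require Import all_boot all_order all_algebra.
From mathcomp Require boolp.
From mathcomp Require Import reals.
From mathcomp Require Import mpoly.
From mathcomp Require Import ring.
Set Implicit Arguments. Unset Strict Implicit. Unset Printing Implicit Defensive.
Import GRing.Theory Num.Theory.
Local Open Scope ring_scope.

(** * Univariate polynomials in characteristic zero *)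

Lemma poly_eq0_horner (R : numDomainType) (p : {poly R}) :
  (forall x, p.[x] = 0) -> p = 0.
Proof.
move=> p0; apply/eqP/negPn/negP => nzp.
have := max_poly_roots (rs := [seq i%:R | i <- iota 0 (size p)]) nzp.
rewrite size_map size_iota ltnn => contra; suff: false by [].
apply: contra; first by apply/allP => x _; apply/rootP.
by rewrite map_inj_uniq ?iota_uniq //; apply: mulrIn; rewrite oner_eq0.
Qed.

(* Otherwise the order of vanishing at x is one less on the left than on the
   right. *)
Lemma poly_linear_ode (R : numDomainType) (f a s : {poly R}) (x : R) :
  f^`() * a = f * s -> root f x -> ~~ root a x -> f = 0.
Proof.
move=> ode fx0 ax; apply/eqP/negPn/negP => nzf.
have [m [q]] := multiplicity_XsubC f x.
rewrite nzf /= => qx fE; case: m fE => [|m] fE.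
  by move: fx0; rewrite fE expr0 mulr1 (negPf qx).
have /eqP : ('X - x%:P) ^+ m * ((q^`() * ('X - x%:P) + q *+ m.+1) * a
                           - q * ('X - x%:P) * s) = 0.
  move/eqP: ode; rewrite -subr_eq0 => /eqP <-.
  rewrite fE derivM deriv_exp derivXsubC mul1r /= exprS -[q *+ _]mulr_natr.
  rewrite -[_ ^+ m *+ _]mulr_natr.
  move: (q^`()) ('X - x%:P) (m.+1%:R) => q' y c; move: (y ^+ m) => ym; ring.
rewrite mulf_eq0 expf_eq0 polyXsubC_eq0 andbF /=.
move=> /eqP /(congr1 (horner^~ x)).
rewrite !hornerE subrr !(mulr0, mul0r) subr0 add0r hornerMn => /eqP.
by rewrite mulf_eq0 mulrn_eq0 /= -!rootE (negPf qx) (negPf ax).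
Qed.

(** * Restriction of a multivariate polynomial to the line t -> z + t k *)

Definition line_poly (n : nat) (R : comNzRingType) (z k : 'I_n -> R) :=
  mmap (@polyC R) (fun i => (z i)%:P + (k i)%:P * 'X).

HB.instance Definition _ n R z k := GRing.RMorphism.on (@line_poly n R z k).

Section Line.
Context (n : nat) (R : comNzRingType).
Implicit Types (p : {mpoly R[n]}) (z k : 'I_n -> R).

Lemma line_polyD z k : {morph line_poly z k : p q / p + q}.
Proof. exact: rmorphD. Qed.

Lemma line_polyB z k : {morph line_poly z k : p q / p - q}.
Proof. exact: rmorphB. Qed.

Lemma line_polyM z k : {morph line_poly z k : p q / p * q}.
Proof. exact: rmorphM. Qed.

Lemma line_polyC z k c : line_poly z k c%:MP = c%:P.
Proof. exact: mmapC. Qed.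

Lemma line_polyZ z k c p : line_poly z k (c *: p) = c%:P * line_poly z k p.
Proof. exact: mmapZ. Qed.

Lemma line_polyX z k i : line_poly z k 'X_i = (z i)%:P + (k i)%:P * 'X.
Proof. by rewrite /line_poly mmapX mmap1U. Qed.

Lemma horner_line_poly z k p t :
  (line_poly z k p).[t] = p.@[fun i => z i + k i * t].
Proof.
elim/mpolyind: p => [|c m p _ _ IH]; first by rewrite rmorph0 meval0 horner0.
rewrite line_polyD line_polyZ !hornerE IH mevalD mevalZ mevalX /line_poly mmapX.
congr (_ * _ + _); rewrite /mmap1 horner_prod; apply: eq_bigr => i _.
by rewrite !hornerE.
Qed.

Lemma mderivXU i j : 'X_i^`M(j) = (i == j)%:R :> {mpoly R[n]}.
Proof.
rewrite mderivX mnm1E; have [-> | _] := eqVneq; last by rewrite scale0r.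
suff -> : (U_(j) - U_(j) = 0 :> 'X_{1..n})%MM by rewrite scale1r mpolyX0.
by apply/mnmP => l; rewrite mnmBE mnm0E subnn.
Qed.

(** Chain rule. The identity [chain] is stable under sums and products and holds for constants and
    variables, which generate all polynomials. *)
Lemma deriv_line_poly z k p :
  (line_poly z k p)^`() = \sum_i (k i)%:P * line_poly z k p^`M(i).
Proof.
pose chain p := (line_poly z k p)^`() = \sum_i (k i)%:P * line_poly z k p^`M(i).
have chainM q r : chain q -> chain r -> chain (q * r).
  rewrite /chain line_polyM derivM => -> ->; rewrite mulr_suml mulr_sumr.
  rewrite -big_split.
  apply: eq_bigr => i _; rewrite mderivM line_polyD !line_polyM /=; ring.
have chainC c : chain c%:MP.
  rewrite /chain line_polyC derivC big1 // => i _.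
  by rewrite mderivC rmorph0 mulr0.
have chainX i : chain 'X_i.
  rewrite /chain line_polyX !derivE add0r mulr1 (bigD1 i) //=.
  rewrite mderivXU eqxx [line_poly _ _ 1]rmorph1 mulr1 big1 ?addr0 // => j ji.
  by rewrite mderivXU eq_sym (negPf ji) [line_poly _ _ 0]rmorph0 mulr0.
rewrite -/(chain p); elim/mpolyind: p => [|c m p _ _ IH].
  exact: chainC.
have: chain (c *: 'X_[m]).
  rewrite -mul_mpolyC; apply: (chainM) => //.
  rewrite mpolyXE_id; apply: (big_ind chain) => [|q r|i _].
  - exact: chainC.
  - exact: chainM.
  - by elim: (m i) => [|e IHe]; [exact: chainC | rewrite exprS; apply: chainM].
move: IH; rewrite /chain line_polyD derivD => -> ->; rewrite -big_split.
by apply: eq_bigr => i _; rewrite mderivD line_polyD mulrDr.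
Qed.

End Line.

(** * Vanishing values and vanishing derivatives *)

Section Zero.
Context (n : nat) (R : numDomainType).
Implicit Types (p : {mpoly R[n]}).

Lemma mnm1_le_neq0 (m : 'X_{1..n}) : m != 0%MM -> exists i, (U_(i) <= m)%MM.
Proof.
move=> m0; apply/existsP; apply: contraNT m0.
rewrite negb_exists => /forallP mi; apply/eqP/mnmP => i.
by rewrite mnm0E; apply/eqP; rewrite -[_ == _]negbK -lep1mP.
Qed.

Lemma meval0_mcoeff p : p.@[fun=> 0] = p@_0.
Proof.
elim/mpolyind: p => [|c m p _ _ IH]; first by rewrite meval0 mcoeff0.
rewrite mevalD mevalZ mevalX mcoeffD mcoeffZ mcoeffX IH; congr (_ * _ + _).
have [->|/mnm1_le_neq0[i mi]] := eqVneq m 0%MM.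
  by apply: big1 => i _; rewrite mnm0E.
by rewrite (bigD1 i) //= expr0n (negPf (_ : m i != 0%N)) ?mul0r -?lep1mP.
Qed.

Lemma mderiv_eq0_const p : (forall i, p^`M(i) = 0) -> p = (p@_0)%:MP.
Proof.
move=> dp0; apply/mpolyP => m; rewrite mcoeffC.
have [->|/mnm1_le_neq0[i mi]] := eqVneq m 0%MM; first by rewrite mulr1.
have/(congr1 (mcoeff (m - U_(i)))) := dp0 i.
rewrite mulr0 mcoeff_mderiv mcoeff0 submK //.
by move/eqP; rewrite mulrn_eq0 /= => /eqP.
Qed.

(** Induction on the degree of the monomial. On a line parallel to an axis the polynomial restricts
    to zero, so its partial derivatives vanish everywhere too. The coefficient at [m] is then read
    off, up to a positive integer factor, from a derivative at a monomial of smaller degree. *)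
Lemma mpoly_eq0_meval p : (forall v, p.@[v] = 0) -> p = 0.
Proof.
suff coef0 d (m : 'X_{1..n}) (q : {mpoly R[n]}) :
    mdeg m = d -> (forall v, q.@[v] = 0) -> q@_m = 0.
  by move=> p0; apply/mpolyP => m; rewrite mcoeff0; apply: coef0.
elim: d m q => [|d IHd] m q.
  by move/eqP; rewrite mdeg_eq0 => /eqP -> q0; rewrite -meval0_mcoeff q0.
move=> md q0; have [|i mi] := @mnm1_le_neq0 m; first by rewrite -mdeg_eq0 md.
suff : q^`M(i)@_(m - U_(i)) = 0.
  by rewrite mcoeff_mderiv submK // => /eqP; rewrite mulrn_eq0 => /eqP.
apply: IHd => [|v].
  by apply/eqP; rewrite -eqSS -md -{2}(submK mi) mdegD mdeg1 addn1.
have : line_poly v (fun j => (j == i)%:R) q = 0.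
  by apply: poly_eq0_horner => t; rewrite horner_line_poly.
move/(congr1 (fun q => (deriv q).[0])); rewrite deriv_line_poly linear0 horner0.
rewrite (bigD1 i) //= big1 ?addr0 => [|j /negPf ->]; last by rewrite mul0r.
rewrite eqxx mul1r horner_line_poly => <-; apply: meval_eq => j.
by rewrite mulr0 addr0.
Qed.
End Zero.

Lemma deriv_eq0_const (R : numDomainType) (p : {poly R}) :
  p^`() = 0 -> p = (p.[0])%:P.
Proof.
move=> dp0; apply/polyP => -[|i]; rewrite coefC /= ?horner_coef0 //.
have /(congr1 (fun q : {poly R} => q`_i)) := dp0.
by rewrite coef_deriv coef0 => /eqP; rewrite mulrn_eq0 => /eqP.
Qed.

(** * Gradients (u, v) with singular Jacobian matrix *)

Section ZeroHessian.
Context (F : numFieldType).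
Implicit Types (u v w : {mpoly F[2]}) (z : 'I_2 -> F).

Local Notation "p '^`x'" := (mderiv (ord0 : 'I_2) p)
  (at level 1, format "p '^`x'").
Local Notation "p '^`y'" := (mderiv (ord_max : 'I_2) p)
  (at level 1, format "p '^`y'").

(** Direction of the characteristics of m_y = m m_x: along it w changes at the rate w_y - m w_x. *)
Let slope_dir (m : F) (i : 'I_2) : F := if i == ord0 then - m else 1.

Lemma deriv_line_slope z m w :
  (line_poly z (slope_dir m) w)^`() =
  line_poly z (slope_dir m) w^`y - m%:P * line_poly z (slope_dir m) w^`x.
Proof.
rewrite deriv_line_poly big_ord_recl big_ord1 /slope_dir /=.
rewrite (_ : lift ord0 ord0 = ord_max); last exact: val_inj.
by rewrite polyCN mul1r mulNr addrC.
Qed.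

(* m_y = m m_x for m := u_y / u_x, with denominators cleared. *)
Lemma slope_burgers u v : u^`y = v^`x -> u^`x * v^`y = u^`y ^+ 2 ->
  u^`x * (u^`y^`y * u^`x - u^`y * u^`x^`y) =
  u^`y * (u^`y^`x * u^`x - u^`y * u^`x^`x).
Proof.
(* The x-derivative of the Hessian relation reads u_xx v_y + u_x u_yy = 2 u_y u_yx, because v_xy =
   u_yy. Multiplied by u_x, it loses v through the relation itself. *)
move=> uvE hess; have := congr1 (mderiv ord0) hess.
rewrite mderivM expr2 mderivM (mderiv_comm ord_max ord0 v) -uvE.
rewrite (mderiv_comm ord0 ord_max u) => dhess.
transitivity (u^`x * (u^`x * u^`y^`y + u^`x^`x * v^`y)
  - u^`x^`x * (u^`x * v^`y) - u^`x * u^`y * u^`y^`x); first by ring.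
by rewrite hess [u^`x * u^`y^`y + _]addrC dhess; ring.
Qed.

(** The derivative of u along the line is u_y - m u_x. It vanishes at the base point by the choice
    of [m] and solves a linear differential equation whose leading coefficient u_x^2 is nonzero
    there, so it is identically zero. *)
Lemma gradx_constant_on_line u v z (m := u^`y.@[z] / u^`x.@[z]) :
  u^`y = v^`x -> u^`x * v^`y = u^`y ^+ 2 -> u^`x.@[z] != 0 ->
  line_poly z (slope_dir m) u = (u.@[z])%:P.
Proof.
move=> uvE hess Ez; pose L := line_poly z (slope_dir m).
have L0 w : (L w).[0] = w.@[z].
  by rewrite horner_line_poly; apply: meval_eq => i; rewrite mulr0 addr0.
have f0 : L (u^`y) - m%:P * L (u^`x) = 0.
  (* The cofactor arises by expanding the derivative of u_y - m u_x, times u_x^2, with the chain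
     rule and substituting the Burgers identity: the result is divisible by u_y - m u_x. *)
  apply: (@poly_linear_ode _ _ (L (u^`x) ^+ 2)
     (L (u^`x) * (L (u^`x^`y) - m%:P * L (u^`x^`x)) +
      L (u^`y^`x) * L (u^`x) - L (u^`y) * L (u^`x^`x)) 0).
  - have /(congr1 L) := slope_burgers uvE hess.
    rewrite /L !(line_polyM, line_polyB) -/L derivB derivM derivC mul0r add0r.
    rewrite !deriv_line_slope -/L.
    move: (L u^`x) (L u^`y) (L u^`x^`x) (L u^`x^`y) (L u^`y^`x) (L u^`y^`y) m%:P.
    move=> e f ex ey fx fy c burgers.
    transitivity (e * (fy * e - f * ey) + e * f * ey
                  - c * e ^+ 2 * (fx + ey - c * ex)); first by ring.
    by rewrite burgers; ring.
  - by rewrite rootE !hornerE !L0 /m divfK // subrr.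
  - by rewrite rootE !hornerE L0 expf_eq0.
by rewrite -L0; apply: deriv_eq0_const; rewrite deriv_line_slope.
Qed.

Lemma hessian0_slope u v : u^`y = v^`x -> u^`x * v^`y = u^`y ^+ 2 ->
  u^`x != 0 -> exists m, u^`y = m *: u^`x /\ v^`y = m *: u^`y.
Proof.
move=> uvE hess nzE.
have [z Ez] : exists z, u^`x.@[z] != 0.
  apply: boolp.contrapT => noz; case/eqP: nzE; apply: mpoly_eq0_meval => z.
  by apply/eqP/negPn/negP => Ez; apply: noz; exists z.
pose m := u^`y.@[z] / u^`x.@[z].
(* The alternative at each point is packed into a product, so that the absence of zero divisors
   turns it into an alternative between polynomials. *)
have : (u - (u.@[z])%:MP) * (u^`y - m *: u^`x) * u^`x = 0.
  apply: mpoly_eq0_meval => z1; rewrite !(mevalM, mevalB, mevalZ, mevalC).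
  have [->|Ez1] := eqVneq (u^`x.@[z1]) 0; first by rewrite !mulr0.
  pose m1 := u^`y.@[z1] / u^`x.@[z1].
  have [mE|m1m] := eqVneq m1 m.
    by rewrite -mE divfK // subrr mulr0 mul0r.
  suff -> : u.@[z1] = u.@[z] by rewrite subrr !mul0r.
  have dm : m - m1 != 0 by rewrite subr_eq0 eq_sym.
  (* The parameters [t] and [t1] at which the lines through [z1] and [z] meet. *)
  pose t := (z ord0 - z1 ord0 + m * (z ord_max - z1 ord_max)) / (m - m1).
  pose t1 := t + z1 ord_max - z ord_max.
  have := congr1 (horner^~ t) (gradx_constant_on_line uvE hess Ez1).
  have := congr1 (horner^~ t1) (gradx_constant_on_line uvE hess Ez).
  rewrite -/m -/m1 !hornerC !horner_line_poly => <- <-; apply: meval_eq => i.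
  have [->|->] : i = ord0 \/ i = ord_max.
    by case: i => [[|[|//]] ?]; [left|right]; apply: val_inj.
    by rewrite /slope_dir /= /t1 /t; field.
  rewrite /slope_dir /= /t1; ring.
move/eqP; rewrite !mulf_eq0 (negPf nzE) orbF => /orP[/eqP uC|/eqP FmE].
  case/eqP: nzE; have -> : u = (u.@[z])%:MP by apply/eqP; rewrite -subr_eq0 uC.
  by rewrite mderivC.
exists m; have {}FmE : u^`y = m *: u^`x by apply/eqP; rewrite -subr_eq0 FmE.
split=> //; apply: (mulfI nzE); rewrite hess expr2 {1}FmE.
by rewrite -scalerAl -scalerAr.
Qed.

(** * Polynomials in a single linear form *)

Lemma ord2_neq (i j l : 'I_2) : i != j -> i != l -> j = l.
Proof.
by case: i j l => [[|[|//]] ?] [[|[|//]] ?] [[|[|//]] ?] // _ _; apply: val_inj.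
Qed.

(** Only the term of the binomial expansion free of ['X_j] contributes to a pure power of ['X_i]. *)
Lemma mcoeff_linear_exp (i j : 'I_2) (c : F) k l : i != j ->
  (('X_i + c *: 'X_j) ^+ l)@_(U_(i) *+ k) = (l == k)%:R.
Proof.
move=> ij; rewrite exprDn raddf_sum /= big_ord_recl big1 => [|s _] /=.
  rewrite addr0 bin0 subn0 mulr1 mpolyXn mcoeffX; congr (_%:R).
  congr nat_of_bool.
  apply/eqP/eqP => [/mnmP/(_ i)|->//].
  by rewrite !mulmnE mnm1E eqxx !mul1n.
rewrite exprZn -scalerAr mcoeffMn mcoeffZ !mpolyXn -mpolyXD mcoeffX.
case: eqP => [/mnmP/(_ j)|]; last by rewrite mulr0 mul0rn.
by rewrite mnmDE !mulmnE !mnm1E eqxx (negPf ij) !mul0n.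
Qed.

(** Both sides solve the same first-order equation. It expresses a coefficient with exponent l + 1
    in ['X_j] through one with exponent l, so a solution is determined by its coefficients on pure
    powers of ['X_i], and these agree. *)
Lemma mpoly_linear_formE (i j : 'I_2) (c : F) (a b : nat) w : i != j ->
  (forall k, ~~ (a <= k < b)%N -> w@_(U_(i) *+ k) = 0) ->
  w^`M(j) = c *: w^`M(i) ->
  w = \sum_(a <= k < b) w@_(U_(i) *+ k) *: ('X_i + c *: 'X_j) ^+ k.
Proof.
move=> ij w0 dw; apply/eqP; rewrite -subr_eq0; set r := _ - _.
have dr : r^`M(j) = c *: r^`M(i).
  rewrite /r !mderivB dw scalerBr; congr (_ - _).
  rewrite !(linear_sum (mderiv _)) scaler_sumr.
  apply: eq_bigr => k _; rewrite /= !mderivZ scalerA mulrC -scalerA.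
  congr (_ *: _).
  elim: k => [|l IHl]; first by rewrite !mderivC scaler0.
  rewrite exprS !mderivM IHl !mderivD !mderivZ !mderivXU !eqxx (negPf ij).
  rewrite eq_sym (negPf ij) scaler0 addr0 add0r scalerDr -!scalerAl -scalerAr.
  by rewrite mul1r.
have r0 k : r@_(U_(i) *+ k) = 0.
  rewrite mcoeffB raddf_sum /=.
  under eq_bigr do rewrite mcoeffZ mcoeff_linear_exp // mulr_natr mulrb.
  rewrite -big_mkcond big_nat1_eq; case: ifPn => [_|/w0->]; by rewrite subrr.
have coef l k : r@_(U_(i) *+ k + U_(j) *+ l) = 0.
  elim: l k => [|l IHl] k; first by rewrite mulm0n addm0.
  have/(congr1 (mcoeff (U_(i) *+ k + U_(j) *+ l))) := dr.
  rewrite mcoeffZ !mcoeff_mderiv -[in LHS]addmA -mulmSr.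
  rewrite [in RHS]addmC addmA [(U_(i) + _)%MM]addmC -mulmSr IHl mul0rn mulr0.
  by move/eqP; rewrite mulrn_eq0 => /eqP.
apply/eqP/mpolyP => m; rewrite mcoeff0 -(coef (m j) (m i)); congr (_@__).
apply/mnmP => l; rewrite mnmDE !mulmnE !mnm1E.
have [<-|il] := eqVneq i l.
  by rewrite eq_sym (negPf ij) mul1n addn0.
by rewrite (ord2_neq ij il) eqxx mul1n.
Qed.
End ZeroHessian.

(** * Degrees of the nonlinear parts, and the theorem *)

Lemma homog_sum_low_coeff (R : nzRingType) (n a b : nat)
    (f : nat -> {mpoly R[n]}) (m : 'X_{1..n}) :
  (forall i, (a <= i < b)%N -> f i \is i.-homog) -> (mdeg m < a)%N ->
  (\sum_(a <= i < b) f i)@_m = 0.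
Proof.
move=> hom ma; rewrite raddf_sum /= big_nat big1 // => i /andP[ai ib].
by rewrite (dhomog_nemf_coeff (hom i _)) ?ai // ltn_eqF // (leq_trans ma).
Qed.

(** Transfers the degree bound from a component of the map to its nonlinear part: from degree 2 on,
    ['X_l] cannot cancel anything. *)
Lemma mcoeff_perturb_eq0 (R : nzRingType) (n d : nat) (w : {mpoly R[n]})
    (i l : 'I_n) k :
  (msize ('X_l + w) <= d)%N -> (forall m, (mdeg m < 2)%N -> w@_m = 0) ->
  ~~ (2 <= k < d)%N -> w@_(U_(i) *+ k) = 0.
Proof.
move=> wd low kd; have [k2|k2] := ltnP k 2.
  by apply: low; rewrite mdegMn mdeg1 mul1n.
have dk : (d <= k)%N by move: kd; rewrite k2 -leqNgt.
have : ('X_l + w)@_(U_(i) *+ k) = 0.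
  apply/eqP; rewrite mcoeff_eq0; apply: msize_mdeg_ge.
  by rewrite mdegMn mdeg1 mul1n (leq_trans wd).
rewrite mcoeffD mcoeffX; case: eqP => [/(congr1 mdeg)|_]; last by rewrite add0r.
by rewrite mdegMn !mdeg1 mul1n => k1; rewrite -k1 in k2.
Qed.

Theorem theorem1 (R : realType) (P Q : {mpoly R[2]}) (n : nat) :
  divfree_jacobian_map P Q -> map_degree P Q = n ->
  exists (alpha beta : R), alpha ^+ 2 + beta ^+ 2 != 0 /\
  exists eps : nat -> R,
    P = vx + \sum_(2 <= i < n.+1) (eps i * alpha) *: (beta *: vx - alpha *: vy) ^+ i /\
    Q = vy + \sum_(2 <= i < n.+1) (eps i * beta) *: (beta *: vx - alpha *: vy) ^+ i.
Proof.
case=> -[c [_ jacc]] [N [ps [qs [homp [homq [PE [QE divf]]]]]]] degn.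
set p := \sum_(2 <= i < N.+1) ps i in PE divf.
set q := \sum_(2 <= i < N.+1) qs i in QE divf.
have lowp m : (mdeg m < 2)%N -> p@_m = 0 by apply: homog_sum_low_coeff.
have lowq m : (mdeg m < 2)%N -> q@_m = 0 by apply: homog_sum_low_coeff.
(* [N] only bounds the given decomposition, whereas the sums sought stop at the degree [n]; these
   bounds make the switch possible. *)
have sP : (msize P <= n.+1)%N.
  by rewrite -degn (leq_trans (leq_maxl _ (msize Q))) // leqSpred.
have sQ : (msize Q <= n.+1)%N.
  by rewrite -degn (leq_trans (leq_maxr (msize P) _)) // leqSpred.
(* The Jacobian determinant is 1 plus the divergence plus this determinant. At the origin the
   derivatives of [p] and [q] vanish, which forces [c] to be 1. *)
have hess : dx p * dy q - dy p * dx q = 0.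
  have : 1 + (dx p * dy q - dy p * dx q) = c%:MP.
    rewrite -jacc PE QE /jac_det /dx /dy !mderivD /vx /vy !mderivXU /=.
    by rewrite -[1 in LHS](addr0) -[in LHS]divf /dx /dy; ring.
  move=> jac1; have c1 : c = 1.
    have := congr1 (meval (fun=> 0)) jac1.
    have D0 (i : 'I_2) w : (forall m, (mdeg m < 2)%N -> w@_m = 0) ->
        w^`M(i).@[fun=> 0] = 0 :> R.
      move=> low; rewrite meval0_mcoeff mcoeff_mderiv low ?mul0rn //.
      by rewrite add0m mdeg1.
    rewrite mevalD mevalB !mevalM meval1 mevalC /dx /dy !D0 //.
    by rewrite !mul0r subrr addr0.
  by apply: (addrI 1); rewrite jac1 c1 addr0.
have divE : dx p = - dy q by apply/eqP; rewrite -addr_eq0 divf.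
have coefp k : ~~ (2 <= k < n.+1)%N -> p@_(U_(ord_max) *+ k) = 0.
  by apply: (@mcoeff_perturb_eq0 _ _ _ p _ ord0) lowp; rewrite -[_ + p]PE.
have coefq k : ~~ (2 <= k < n.+1)%N -> q@_(U_(ord0) *+ k) = 0.
  by apply: (@mcoeff_perturb_eq0 _ _ _ q _ ord_max) lowq; rewrite -[_ + q]QE.
have const0 w : (forall m, (mdeg m < 2)%N -> w@_m = 0) ->
    dx w = 0 -> dy w = 0 -> w = 0 :> {mpoly R[2]}.
  move=> low wx wy; rewrite [w]mderiv_eq0_const ?low ?mdeg0 ?mpolyC0 // => i.
  have [-> //|i0] := eqVneq i ord0.
  by rewrite (@ord2_neq ord0 i ord_max) // eq_sym.
(* If q_x = 0 there is no slope to form, but the Hessian relation gives q_y^2 = 0. Hence q = 0 and p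
   depends on y alone. *)
have [qx0|qx] := eqVneq (dx q) 0.
  have qy0 : dy q = 0.
    apply/eqP; rewrite -sqrf_eq0 expr2; move/eqP: hess.
    by rewrite qx0 mulr0 subr0 divE mulNr oppr_eq0.
  exists 1, 0; split; first by rewrite expr1n expr0n addr0 oner_eq0.
  (* For alpha = 1 and beta = 0 the linear form is -y, whence the sign. *)
  exists (fun k => p@_(U_(ord_max) *+ k) * (-1) ^+ k); split; last first.
    rewrite big1 => [|k _]; last by rewrite mulr0 scale0r.
    by rewrite addr0 QE (const0 q) ?addr0.
  rewrite {1}PE; congr (_ + _).
  rewrite {1}[p](@mpoly_linear_formE _ ord_max ord0 0 2 n.+1) //; last first.
    by rewrite scale0r -[LHS]/(dx p) divE qy0 oppr0.
  apply: eq_bigr => k _; rewrite !scale0r addr0 sub0r scale1r mulr1.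
  by rewrite -scaleN1r exprZn scalerA -mulrA -exprMn mulrNN mulr1 expr1n mulr1.
have uvE : dy (- q) = dx p by rewrite /dy mderivN divE.
have [||m [uy vy_]] := @hessian0_slope R (- q) p uvE.
- move/eqP: hess; rewrite subr_eq0 -/(dx _) -/(dy _) -/(dy _) uvE => /eqP hess.
  by rewrite /dx mderivN mulNr mulrC -hess -/(dx _) divE expr2 mulrN mulNr.
- by rewrite mderivN oppr_eq0.
have qym : q^`M(ord_max) = m *: q^`M(ord0).
  by apply: oppr_inj; rewrite -scalerN -!mderivN.
(* The gradient of p + m q is zero, and there is no constant term. *)
have pE : p = (- m) *: q.
  apply/eqP; rewrite -subr_eq0; apply/eqP; apply: const0 => [l l2||].
  - by rewrite mcoeffB mcoeffZ lowp ?lowq // mulr0 subr0.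
  - rewrite /dx mderivB mderivZ -/(dx _) -/(dx _) divE /dy qym scaleNr.
    by rewrite opprK addNr.
  - rewrite /dy mderivB mderivZ vy_ mderivN scalerN scaleNr.
    by rewrite subrr.
have qE := mpoly_linear_formE (isT : ord0 != ord_max :> 'I_2) coefq qym.
(* With alpha = -m and beta = 1 the linear form is x + m y, in which [qE] expands q. *)
exists (- m), 1; split.
  by rewrite expr1n lt0r_neq0 // ltr_wpDl ?sqr_ge0 ?ltr01.
exists (fun k => q@_(U_(ord0) *+ k)); rewrite scale1r scaleNr opprK.
split; last by rewrite {1}QE {1}qE; under [in RHS]eq_bigr do rewrite mulr1.
rewrite {1}PE pE {1}qE scaler_sumr; congr (_ + _).
by apply: eq_bigr => k _; rewrite scalerA mulrC.
Qed.
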